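(* Let $m$ and $N$ be integers with $0<m<N$ and let $\alpha$ be a positive real number. Define $$M(P)=\frac{\alpha}{1-\alpha(1-P)},\qquad f(P)=\lim_{P'\to P}\frac{\binom{N-1}{m}\left(M(P')\right)^m}{\sum_{X=0}^{m}\binom{N-1}{X}\left(M(P')\right)^X}.$$ Then there exists a unique probability $P^\star\in[0,1]$ satisfying $P^\star=f(P^\star)$.
   Context: $P$ and $P'$ are real variables. The limit in the definition of $f$ serves to remove the removable discontinuity at $P=1-1/\alpha$ (where the denominator of $M$ vanishes). The function $f$ may have nonremovable discontinuities (points at which the limit does not exist) at some negative values of $P$, where $f$ is left undefined. The equation $P=f(P)$ is called the Engset formula. *)

(* Defs.v *)
From HB Require Import structures.
From mathcomp Require Import all_boot all_order all_algebra.
From mathcomp Require Import all_classical all_reals all_analysis.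

Set Implicit Arguments.
Unset Strict Implicit.
Unset Printing Implicit Defensive.

Import Order.TTheory GRing.Theory Num.Theory.
Import numFieldNormedType.Exports.

Local Open Scope classical_set_scope.
Local Open Scope ring_scope.

Definition engset_M (R : realType) (alpha P : R) : R :=
  alpha / (1 - alpha * (1 - P)).

Definition engset_ratio (R : realType) (m N : nat) (alpha P : R) : R :=
  ('C(N.-1, m)%:R * engset_M alpha P ^+ m) /
  \sum_(0 <= X < m.+1) 'C(N.-1, X)%:R * engset_M alpha P ^+ X.

(* The limit is over the punctured neighborhoods [P^'], so the values that the
   convention 0^-1 = 0 gives to [engset_ratio] at [P] itself play no role. *)
Definition engset_defined (R : realType) (m N : nat) (alpha P : R) : Prop :=
  cvg (engset_ratio m N alpha P' @[P' --> P^']).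

(* Meaningful only when [engset_defined m N alpha P] holds: [lim] returns a
   default value when there is no limit. *)
Definition engset_f (R : realType) (m N : nat) (alpha P : R) : R :=
  lim (engset_ratio m N alpha P' @[P' --> P^']).

(* Main.v *)
Require Import Defs.
From mathcomp Require Import all_boot all_order all_algebra.
From mathcomp Require Import all_classical all_reals all_analysis.
From mathcomp Require Import ring lra.

Import Order.TTheory GRing.Theory Num.Theory.
Import numFieldNormedType.Exports.

Local Open Scope classical_set_scope.
Local Open Scope ring_scope.

(** Put [n = N - 1] and [y = 1 / M(P) = P + 1 / alpha - 1].  Multiplying the
    numerator and the denominator of the defining fraction by [y ^ m] turns it
    into [C(n, m) / h(y)] with [h(y) = \sum_(X <= m) C(n, X) y ^ (m - X)], a
    polynomial for which [y = 0] is no longer exceptional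
    ([engset_ratioE]); hence [f(P) = C(n, m) / h(y)] wherever [h(y) <> 0]
    ([engset_ratio_cvg]).

    For [P >= 0] one has [y > -1], but [y] may be negative when [alpha > 1], so
    the signs of the terms of [h] say nothing.  The expansion of [h] in powers
    of [1 + y] does have nonnegative coefficients: Pascal's rule gives
    [h_(n+1, m+1) = (1 + y) h_(n, m) + C(n, m+1)] ([binomial_sumSS]).  Thus [h]
    is positive and nondecreasing on [y > -1].

    On [[0, 1]] the Engset formula therefore reads [P h(y) = C(n, m)].  The
    left-hand side is continuous and strictly increasing, vanishes at [P = 0],
    and at [P = 1], where [y = 1 / alpha > 0], it is at least the term [X = m]
    of [h], which is [C(n, m)].  The intermediate value theorem concludes. *)

Definition binomial_sum {R : pzRingType} (n m : nat) (y : R) : R :=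
  \sum_(0 <= X < m.+1) 'C(n, X)%:R * y ^+ (m - X).

Lemma binomial_sum0 (R : pzRingType) (n : nat) (y : R) :
  binomial_sum n 0 y = 1.
Proof. by rewrite /binomial_sum big_nat1 bin0 mulr1. Qed.

(** Horner's scheme. *)
Lemma binomial_sumS (R : comPzRingType) (n m : nat) (y : R) :
  binomial_sum n m.+1 y = y * binomial_sum n m y + 'C(n, m.+1)%:R.
Proof.
rewrite /binomial_sum big_nat_recr //= subnn mulr1; congr (_ + _).
rewrite big_distrr /=; apply: eq_big_nat => X /andP[_ ltXm].
by rewrite subSn // exprS mulrCA.
Qed.

Lemma binomial_sum_pascal (R : comPzRingType) (n m : nat) (y : R) :
  binomial_sum n.+1 m.+1 y = binomial_sum n m.+1 y + binomial_sum n m y.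
Proof.
elim: m => [|m IHm].
  by rewrite !binomial_sumS !binomial_sum0 !bin1 -natr1 addrA.
rewrite binomial_sumS IHm binS natrD [binomial_sum n m.+2 y]binomial_sumS.
rewrite [X in _ = _ + _ + X]binomial_sumS; ring.
Qed.

(** One step of the expansion in powers of [1 + y], whose coefficients are
    nonnegative as long as the lower index does not exceed the upper one: by
    induction, positivity and monotonicity extend from [y > 0] to [y > -1]. *)
Lemma binomial_sumSS (R : comPzRingType) (n m : nat) (y : R) :
  binomial_sum n.+1 m.+1 y
  = (1 + y) * binomial_sum n m y + 'C(n, m.+1)%:R.
Proof. by rewrite binomial_sum_pascal binomial_sumS; ring. Qed.

Lemma binomial_sum_gt0 (R : realDomainType) (n m : nat) (y : R) :
  (m <= n)%N -> -1 < y -> 0 < binomial_sum n m y.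
Proof.
move=> + y_gt; elim: m n => [|m IHm] [|n] // lemn; rewrite ?binomial_sum0 //.
rewrite binomial_sumSS ltr_wpDr ?ler0n // mulr_gt0 ?IHm //; lra.
Qed.

Lemma binomial_sum_le (R : realDomainType) (n m : nat) (y z : R) :
  (m <= n)%N -> -1 < y -> y <= z -> binomial_sum n m y <= binomial_sum n m z.
Proof.
move=> + y_gt leyz; elim: m n => [|m IHm] [|n] // lemn; rewrite ?binomial_sum0 //.
have h_gt0 := @binomial_sum_gt0 R n m y lemn y_gt.
by rewrite !binomial_sumSS lerD2r ler_pM ?IHm ?(ltW h_gt0) //; lra.
Qed.

Lemma binomial_sum_ge_last (R : realDomainType) (n m : nat) (y : R) :
  0 <= y -> 'C(n, m)%:R <= binomial_sum n m y.
Proof.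
move=> y_ge0; rewrite /binomial_sum big_nat_recr //= subnn mulr1 lerDr.
by apply: sumr_ge0 => X _; rewrite mulr_ge0 ?ler0n ?exprn_ge0.
Qed.

Lemma continuous_binomial_sum (R : realType) (n m : nat) :
  continuous (@binomial_sum R n m).
Proof.
elim: m => [|m IHm] y.
  have -> : @binomial_sum R n 0 = cst 1.
    by apply/funext => z; rewrite binomial_sum0.
  exact: cvg_cst.
have -> : @binomial_sum R n m.+1
    = (fun z => z * binomial_sum n m z + 'C(n, m.+1)%:R).
  by apply/funext => z; rewrite binomial_sumS.
by apply: cvgD; [apply: cvgM; [exact: cvg_id|exact: IHm]|exact: cvg_cst].
Qed.

(** [1 / M(P)] as a polynomial in [P], so that it makes sense everywhere. *)
Definition engset_y {R : realType} (alpha P : R) : R := P + (alpha^-1 - 1).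

Lemma engset_ME (R : realType) (alpha P : R) :
  alpha != 0 -> engset_M alpha P = (engset_y alpha P)^-1.
Proof.
move=> a0; rewrite /engset_M /engset_y.
have -> : 1 - alpha * (1 - P) = alpha * (P + (alpha^-1 - 1)) by field.
by rewrite invfM mulrA mulfV // mul1r.
Qed.

Lemma continuous_engset_y (R : realType) (alpha : R) :
  continuous (@engset_y R alpha).
Proof. by move=> P; apply: cvgD; [exact: cvg_id|exact: cvg_cst]. Qed.

Lemma continuous_binomial_sum_engset_y (R : realType) (n m : nat) (alpha : R) :
  continuous (fun P => binomial_sum n m (engset_y alpha P)).
Proof.
move=> P; apply: (@continuous_comp _ _ _ (engset_y alpha)).
  exact: continuous_engset_y.
exact: continuous_binomial_sum.
Qed.

(** Both fractions are extended by [0^-1 = 0]; as [y ^ m] is invertible, their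
    denominators vanish together, so the equality persists there. *)
Lemma engset_ratioE (R : realType) (m N : nat) (alpha P : R) :
  alpha != 0 -> engset_y alpha P != 0 ->
  engset_ratio m N alpha P
  = 'C(N.-1, m)%:R / binomial_sum N.-1 m (engset_y alpha P).
Proof.
move=> a0; rewrite /engset_ratio engset_ME //.
move: (engset_y alpha P) => y y0.
have -> : \sum_(0 <= X < m.+1) 'C(N.-1, X)%:R * y^-1 ^+ X
    = binomial_sum N.-1 m y * y^-1 ^+ m.
  rewrite /binomial_sum big_distrl /=; apply: eq_big_nat => X /andP[_ leXm].
  have -> : y^-1 ^+ m = y^-1 ^+ (m - X) * y^-1 ^+ X by rewrite -exprD subnK.
  by rewrite -mulrA [y ^+ _ * _]mulrA -exprMn divff // expr1n mul1r.
by rewrite -mulf_div divff ?mulr1 // expf_neq0 // invr_eq0.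
Qed.

Lemma engset_ratio_cvg (R : realType) (m N : nat) (alpha P : R) :
  alpha != 0 -> binomial_sum N.-1 m (engset_y alpha P) != 0 ->
  engset_ratio m N alpha P' @[P' --> P^'] -->
  'C(N.-1, m)%:R / binomial_sum N.-1 m (engset_y alpha P).
Proof.
move=> a0 h0.
(* The pole of [engset_M] is a single point, and a punctured neighborhood of
   [P] avoids it even when that point is [P]. *)
have near_y0 : \forall P' \near P^', engset_y alpha P' != 0.
  have [yP0|yP0] := eqVneq (engset_y alpha P) 0.
    near=> P'; have /eqP P'P : P' != P by near: P'; exact: nbhs_dnbhs_neq.
    apply/eqP => yP'0; apply: P'P; apply: (addIr (alpha^-1 - 1)).
    by rewrite -/(engset_y alpha P') yP'0 -yP0.
  apply: nbhs_dnbhs.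
  exact: (cvgr_neq0 _ (continuous_engset_y _ alpha P) yP0).
have h_cvg : 'C(N.-1, m)%:R / binomial_sum N.-1 m (engset_y alpha P')
    @[P' --> P] --> 'C(N.-1, m)%:R / binomial_sum N.-1 m (engset_y alpha P).
  apply: cvgM; first exact: cvg_cst.
  by apply: cvgV => //; exact: continuous_binomial_sum_engset_y.
apply: cvg_trans (cvg_within_filter _ h_cvg).
apply: near_eq_cvg; near=> P'; rewrite -engset_ratioE //.
by near: P'.
Unshelve. all: by end_near. Qed.

Theorem theorem3 (R : realType) (m N : nat) (alpha : R)
    (hm : (0 < m)%N) (hmN : (m < N)%N) (halpha : 0 < alpha) :
  exists! P : R,
    [/\ 0 <= P <= 1, engset_defined m N alpha P & P = engset_f m N alpha P].
Proof.
have a0 : alpha != 0 by rewrite gt_eqF.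
have lemN : (m <= N.-1)%N by rewrite -ltnS (ltn_predK hmN).
have ai_gt0 : 0 < alpha^-1 by rewrite invr_gt0.
pose h P := binomial_sum N.-1 m (engset_y alpha P).
have y_gt P : 0 <= P -> -1 < engset_y alpha P by rewrite /engset_y; lra.
have h_gt0 P : 0 <= P -> 0 < h P by move=> ?; exact/binomial_sum_gt0/y_gt.
have h_neq0 P : 0 <= P -> h P != 0 by move=> P0; rewrite gt_eqF ?h_gt0.
have fE P : 0 <= P -> engset_f m N alpha P = 'C(N.-1, m)%:R / h P.
  by move=> P0; apply: cvg_lim => //; exact/engset_ratio_cvg/h_neq0.
have fixE P : 0 <= P -> P = engset_f m N alpha P <-> P * h P = 'C(N.-1, m)%:R.
  move=> P0; rewrite fE //; split => [{1}->|<-].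
    by rewrite divfK ?h_neq0.
  by rewrite mulfK ?h_neq0.
have incr P Q : 0 <= P -> P < Q -> P * h P < Q * h Q.
  move=> P0 ltPQ; have Q0 : 0 <= Q by lra.
  apply: (@le_lt_trans _ _ (P * h Q)); last by rewrite ltr_pM2r ?h_gt0.
  apply: ler_wpM2l => //; apply: binomial_sum_le => //; first exact: y_gt.
  by rewrite lerD2r ltW.
have [P /[!in_itv]/= P01 hP] :
    exists2 P, P \in `[0, 1]%R & P * h P = 'C(N.-1, m)%:R.
  apply: (@IVT R (fun P => P * h P)) => //.
    apply: continuous_subspaceT => P; apply: cvgM; first exact: cvg_id.
    exact: continuous_binomial_sum_engset_y.
  have C_le : 'C(N.-1, m)%:R <= h 1.
    by apply: binomial_sum_ge_last; rewrite /engset_y; lra.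
  by rewrite mul0r mul1r ge_min le_max ler0n C_le orbT.
have P0 : 0 <= P by case/andP: P01.
exists P; split.
  split=> //; last exact/fixE.
  by apply/cvg_ex; eexists; exact/engset_ratio_cvg/h_neq0.
move=> Q [/andP[Q0 _] _ /(fixE _ Q0) hQ].
case: (ltgtP P Q) => // [/(incr _ _ P0)|/(incr _ _ Q0)]; rewrite hP hQ ltxx //.
Qed.
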